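(* $$\sum_{k=1}^\infty\frac{2^k}{k^2\binom{2k}{k}}\left(6S_1(2k)-11S_1(k)+\frac8k\right)=2\pi C.$$
   Context: $S_1(n):=\sum_{i=1}^n \frac1i$ is the $n$-th harmonic number, and $C=\sum_{k=0}^\infty \frac{(-1)^k}{(2k+1)^2}$ is Catalan's constant. *)

(* Defs.v *)
(* Stdlib real numbers with Coquelicot. *)
From Stdlib Require Import Reals.
From Coquelicot Require Import Coquelicot.
Open Scope R_scope.

Definition S_1 (n : nat) : R := sum_n_m (fun i : nat => 1 / INR i) 1 n.

(* [Series] is total; here the alternating series converges (absolutely),
   so it denotes the actual sum. *)
Definition Catalan : R :=
  Series (fun k : nat => (-1) ^ k / INR (2 * k + 1) ^ 2).

(* The binomial coefficient is written [Binomial.C] because Coquelicot's [C]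
   is the type of complex numbers. *)
Definition summand (k : nat) : R :=
  2 ^ k / (INR k ^ 2 * Binomial.C (2 * k) k)
  * (6 * S_1 (2 * k) - 11 * S_1 k + 8 / INR k).

(* Main.v *)
Require Import Defs.
From Stdlib Require Import Reals Lra Lia.
From Coquelicot Require Import Coquelicot.
Open Scope R_scope.

(** Put y = (1 - cos x) / 2, so that y = 1/2 at x = PI/2, and regard the sum as
    the value at y = 1/2 of F(y), the power series with coefficients
    b_k h_k / k, where b_k = 4^k / (k C(2k,k)) and
    h_k = 6 S_1(2k) - 11 S_1(k) + 8/k.  Let B and T be the power series with
    coefficients b_(n+1) and b_(n+1) h_(n+1).

    The recurrence (2k + 1) b_(k+1) = 2k b_k says exactly that sin x * B(y) has
    derivative 2, hence equals 2x ([sin_PSeries_wallis]).  The step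
    h_(k+1) - h_k = 6/(2k+1) - 8/k is a combination that this recurrence
    absorbs, so sin x * T(y) has derivative (8 cos x - 2) B(y)
    ([is_derive_sin_PSeries_weighted]); and F(y) has derivative
    sin x * T(y) / 2.  Taylor's formula with integral remainder then gives

      F(1/2) = integral from 0 to PI/2 of
               x (PI/2 - x) (8 cos x - 2) / sin x dx.

    A Dirichlet kernel expands (8 cos x - 2) / sin x as a finite sine sum, plus
    an oscillating remainder divided by sin x ([sin_kernel]).  Integrating
    x (PI/2 - x) sin (m x) produces inverse squares and inverse cubes of m.  The
    inverse cubes of the even frequencies cancel those of the odd ones, and
    what is left is 2 PI times a partial sum of Catalan's series
    ([kernel_moment_term_eval]).  The remainder tends to 0 as in the
    Riemann-Lebesgue lemma.

    All integrals are replaced by explicit primitives: [defect] collects them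
    into one function whose derivative is O(1/n) uniformly on the interval, and
    the mean value theorem bounds the difference between F(1/2) and the n-th
    partial sum of the Catalan side ([catalan_partial_sums]). *)

(** * The coefficients *)

(** The number b_(n+1): the shift makes it the Wallis product
    2 (2/3) (4/5) ... (2n / (2n+1)). *)
Definition wallis (n : nat) : R :=
  4 ^ S n / (INR (S n) * Binomial.C (2 * S n) (S n)).

Definition harm (n : nat) : R :=
  6 * S_1 (2 * S n) - 11 * S_1 (S n) + 8 / INR (S n).

Definition weighted (n : nat) : R := wallis n * harm n.

Lemma INR_S_pos (n : nat) : 0 < INR (S n).
Proof. apply lt_0_INR; lia. Qed.

Lemma wallis_0 : wallis 0 = 2.
Proof. unfold wallis, Binomial.C; simpl; field. Qed.

Lemma wallis_S (n : nat) :
  (2 * INR n + 3) * wallis (S n) = (2 * INR n + 2) * wallis n.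
Proof.
unfold wallis, Binomial.C.
replace (2 * S (S n) - S (S n))%nat with (S (S n)) by lia.
replace (2 * S n - S n)%nat with (S n) by lia.
replace (2 * S (S n))%nat with (S (S (2 * S n))) by lia.
rewrite !(fact_simpl (S (2 * S n))), !(fact_simpl (2 * S n)), !(fact_simpl (S n)).
rewrite !mult_INR.
assert (Hf := INR_fact_neq_0 (2 * S n)).
assert (Hg := INR_fact_neq_0 (S n)).
set (f := INR (Factorial.fact (2 * S n))) in *.
set (g := INR (Factorial.fact (S n))) in *.
rewrite !S_INR, !mult_INR, !S_INR.
assert (Hn := pos_INR n).
simpl INR. simpl pow.
field.
repeat split; try assumption; lra.
Qed.

Lemma S_1_S (n : nat) : S_1 (S n) = S_1 n + 1 / INR (S n).
Proof.
unfold S_1.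
rewrite sum_n_Sm by lia.
reflexivity.
Qed.

Lemma harm_0 : harm 0 = 6.
Proof.
unfold harm.
replace (2 * 1)%nat with 2%nat by lia.
rewrite !S_1_S.
unfold S_1; rewrite sum_n_m_zero by lia.
simpl; unfold zero; simpl; field.
Qed.

(** The terms in 1/(n+2) cancel because 6/2 - 11 + 8 = 0; this is what makes the
    multiple of 1/k in the summand the right one. *)
Lemma harm_S (n : nat) :
  harm (S n) = harm n + 6 / (2 * INR n + 3) - 8 / (INR n + 1).
Proof.
unfold harm.
replace (2 * S (S n))%nat with (S (S (2 * S n))) by lia.
rewrite !(S_1_S (S (2 * S n))), !(S_1_S (2 * S n)), (S_1_S (S n)).
rewrite !S_INR, !mult_INR, !S_INR.
assert (Hn := pos_INR n).
simpl INR.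
field.
repeat split; lra.
Qed.

Lemma weighted_S (n : nat) :
  (2 * INR n + 3) * weighted (S n) - (2 * INR n + 2) * weighted n
  = 6 * wallis (S n) - 16 * wallis n.
Proof.
unfold weighted.
assert (Hn := pos_INR n).
assert (Hw : wallis (S n) = (2 * INR n + 2) * wallis n / (2 * INR n + 3)).
{ rewrite <- wallis_S; field; lra. }
rewrite harm_S, Hw.
field; lra.
Qed.

Lemma summand_weighted (n : nat) :
  summand (S n) = weighted n / INR (S n) * (1 / 2) ^ S n.
Proof.
unfold summand, weighted, wallis.
fold (harm n).
replace 4 with (2 * 2) by ring.
rewrite (Rpow_mult_distr 2 2).
replace (1 / 2) with (/ 2) by field; rewrite pow_inv.
assert (H2 : 2 ^ S n <> 0) by (apply pow_nonzero; lra).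
assert (Hn := INR_S_pos n).
assert (HC : Binomial.C (2 * S n) (S n) <> 0).
{ unfold Binomial.C, Rdiv.
  apply Rmult_integral_contrapositive; split; [apply INR_fact_neq_0|].
  apply Rinv_neq_0_compat, Rmult_integral_contrapositive.
  split; apply INR_fact_neq_0. }
field.
repeat split; try assumption; lra.
Qed.

(** * Power series in (1 - cos x) / 2 *)

(** Only radius of convergence greater than 1/2 matters, and the ratio 3/2 leaves
    room to absorb the linear growth of the harmonic factor. *)
Definition geom_bounded (a : nat -> R) : Prop :=
  exists M : R, forall n : nat, Rabs (a n) <= M * (3 / 2) ^ n.

Lemma geom_bounded_radius (a : nat -> R) (y : R) :
  geom_bounded a -> Rabs y <= 1 / 2 -> Rbar_lt (Rabs y) (CV_radius a).
Proof.
intros [M HM] Hy.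
apply Rbar_lt_le_trans with (Finite (2 / 3)); [simpl; lra|].
apply (CV_radius_bounded a).
exists M; intros n.
rewrite Rabs_mult, (Rabs_pos_eq ((2 / 3) ^ n)) by (apply pow_le; lra).
replace M with (M * (3 / 2) ^ n * (2 / 3) ^ n).
- apply Rmult_le_compat_r; [apply pow_le; lra | apply HM].
- rewrite Rmult_assoc, <- Rpow_mult_distr.
  replace (3 / 2 * (2 / 3)) with 1 by field.
  rewrite pow1; ring.
Qed.

Lemma wallis_bounds (n : nat) : 0 <= wallis n <= 2.
Proof.
induction n as [|n IH]; [rewrite wallis_0; lra|].
assert (Hn := pos_INR n).
assert (H := wallis_S n).
nra.
Qed.

Lemma wallis_geom_bounded : geom_bounded wallis.
Proof.
exists 2; intros n.
assert (Hw := wallis_bounds n).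
rewrite Rabs_pos_eq by lra.
assert (1 <= (3 / 2) ^ n) by (apply pow_R1_Rle; lra).
lra.
Qed.

Lemma harm_bound (n : nat) : Rabs (harm n) <= 8 * (INR n + 1).
Proof.
induction n as [|n IH].
- rewrite harm_0, Rabs_pos_eq; simpl; lra.
- rewrite harm_S, S_INR.
  assert (Hn := pos_INR n).
  assert (H6 : 0 <= 6 / (2 * INR n + 3) <= 2).
  { split; [apply Rdiv_le_0_compat; lra|].
    apply Rle_div_l; lra. }
  assert (H8 : 0 <= 8 / (INR n + 1) <= 8).
  { split; [apply Rdiv_le_0_compat; lra|].
    apply Rle_div_l; lra. }
  apply Rabs_le_between in IH.
  apply Rabs_le_between; lra.
Qed.

Lemma weighted_geom_bounded : geom_bounded weighted.
Proof.
exists 32; intros n.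
assert (Hp : INR n + 1 <= 2 * (3 / 2) ^ n).
{ induction n as [|n IH]; [simpl; lra|].
  rewrite S_INR; simpl pow.
  destruct n as [|n]; [simpl; lra|].
  rewrite S_INR in *; assert (Hn := pos_INR n); lra. }
unfold weighted; rewrite Rabs_mult.
assert (Hw := wallis_bounds n).
rewrite (Rabs_pos_eq (wallis n)) by lra.
assert (Hh := harm_bound n).
assert (H0 := Rabs_pos (harm n)).
nra.
Qed.

Definition hav (x : R) : R := (1 - cos x) / 2.

Lemma hav_range (x : R) : 0 <= x <= PI / 2 -> Rabs (hav x) <= 1 / 2.
Proof.
intros Hx; unfold hav.
assert (0 <= cos x) by (apply cos_ge_0; lra).
assert (H1 := COS_bound x).
apply Rabs_le_between; lra.
Qed.

Lemma is_derive_hav (x : R) : is_derive hav x (sin x / 2).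
Proof. unfold hav; auto_derive; [trivial|field]. Qed.

Lemma is_derive_PSeries_hav (a : nat -> R) (x : R) :
  geom_bounded a -> 0 <= x <= PI / 2 ->
  is_derive (fun t => PSeries a (hav t)) x
    (sin x / 2 * PSeries (PS_derive a) (hav x)).
Proof.
intros Ha Hx.
apply (is_derive_comp (PSeries a) hav); [|apply is_derive_hav].
apply is_derive_PSeries, geom_bounded_radius, hav_range; assumption.
Qed.

(** Since y' = sin x / 2 and sin^2 x = 4 y (1 - y), differentiating
    sin x * A(y) gives (1 - 2y) A + 2y (1 - y) A', again a power series in y;
    these are its coefficients. *)
Definition sin_derive_coef (a : nat -> R) (n : nat) : R :=
  match n with
  | O => a O
  | S m => (2 * INR m + 3) * a (S m) - (2 * INR m + 2) * a m
  end.

Lemma is_derive_sin_PSeries (a : nat -> R) (x : R) :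
  geom_bounded a -> 0 <= x <= PI / 2 ->
  is_derive (fun t => sin t * PSeries a (hav t)) x
    (PSeries (sin_derive_coef a) (hav x)).
Proof.
intros Ha Hx.
set (y := hav x).
assert (Hr : Rbar_lt (Rabs y) (CV_radius a))
  by (apply geom_bounded_radius, hav_range; assumption).
assert (HA : is_pseries a y (PSeries a y))
  by (apply PSeries_correct, CV_radius_inside, Hr).
assert (HD : is_pseries (PS_derive a) y (PSeries (PS_derive a) y)).
{ apply PSeries_correct, CV_radius_inside.
  rewrite CV_radius_derive; exact Hr. }
replace (PSeries (sin_derive_coef a) y) with
  ((1 - 2 * y) * PSeries a y + 2 * y * (1 - y) * PSeries (PS_derive a) y).
- apply (is_derive_ext (fun t => mult (sin t) (PSeries a (hav t))));
    [reflexivity|].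
  replace ((1 - 2 * y) * PSeries a y + 2 * y * (1 - y) * PSeries (PS_derive a) y)
    with (plus (mult (cos x) (PSeries a y))
               (mult (sin x) (sin x / 2 * PSeries (PS_derive a) y))).
  + apply (is_derive_mult sin (fun t => PSeries a (hav t))).
    * apply is_derive_sin.
    * apply is_derive_PSeries_hav; assumption.
    * intros; apply Rmult_comm.
  + unfold plus, mult; simpl.
    assert (Hs := sin2_cos2 x); unfold Rsqr in Hs.
    assert (Hc : cos x = 1 - 2 * y) by (unfold y, hav; field).
    assert (Hs' : sin x * sin x = 4 * (y * (1 - y)))
      by (rewrite Hc in Hs; lra).
    replace (sin x * (sin x / 2 * PSeries (PS_derive a) y))
      with ((sin x * sin x) / 2 * PSeries (PS_derive a) y) by field.
    rewrite Hs', Hc; field.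
- symmetry; apply is_pseries_unique.
  assert (HA1 := is_pseries_incr_1 _ _ _ HA).
  assert (HD1 := is_pseries_incr_1 _ _ _ HD).
  assert (HD2 := is_pseries_incr_1 _ _ _ HD1).
  assert (H1 := is_pseries_plus _ _ _ _ _
    (is_pseries_plus _ _ _ _ _ HA
      (is_pseries_scal (-2) _ _ _ (Rmult_comm _ _) HA1))
    (is_pseries_plus _ _ _ _ _
      (is_pseries_scal 2 _ _ _ (Rmult_comm _ _) HD1)
      (is_pseries_scal (-2) _ _ _ (Rmult_comm _ _) HD2))).
  replace ((1 - 2 * y) * PSeries a y + 2 * y * (1 - y) * PSeries (PS_derive a) y)
    with (plus (plus (PSeries a y) (scal (-2) (scal y (PSeries a y))))
           (plus (scal 2 (scal y (PSeries (PS_derive a) y)))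
             (scal (-2) (scal y (scal y (PSeries (PS_derive a) y))))))
    by (unfold plus, scal; simpl; unfold mult; simpl; ring).
  revert H1; apply is_pseries_ext; intros [|[|n]];
    unfold PS_plus, PS_scal, PS_incr_1, PS_derive, plus, scal, zero; simpl;
    unfold mult; simpl; ring.
Qed.

(** The recurrence for [wallis] kills every coefficient of the derivative except
    the constant one, which is 2.  In other words B(y) = 2x / sin x, the
    classical series for the square of the arcsine; stated as a product it
    remains meaningful at x = 0. *)
Lemma sin_PSeries_wallis (x : R) :
  0 <= x <= PI / 2 -> sin x * PSeries wallis (hav x) = 2 * x.
Proof.
intros [H0 Hx].
destruct H0 as [H0|<-]; [|rewrite sin_0; ring].
assert (He : sin 0 * PSeries wallis (hav 0) - 2 * 0
             = sin x * PSeries wallis (hav x) - 2 * x).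
{ apply (eq_is_derive (fun t => sin t * PSeries wallis (hav t) - 2 * t));
    [|exact H0].
  intros t Ht.
  change (is_derive (fun t => sin t * PSeries wallis (hav t) - 2 * t) t 0).
  replace 0 with (minus (PSeries (sin_derive_coef wallis) (hav t)) 2).
  - apply (is_derive_minus (fun t => sin t * PSeries wallis (hav t))
             (fun t => 2 * t)).
    + apply is_derive_sin_PSeries; [apply wallis_geom_bounded|lra].
    + auto_derive; [trivial|ring].
  - replace (PSeries (sin_derive_coef wallis) (hav t)) with 2;
      [unfold minus, plus, opp; simpl; ring|].
    symmetry; apply is_pseries_unique, is_pseries_R.
    assert (Hs : forall n, sin_derive_coef wallis (S n) * hav t ^ S n = 0).
    { intros n; simpl sin_derive_coef; rewrite wallis_S; ring. }
    apply is_series_decr_1.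
    apply (is_series_ext (fun _ => 0)); [intros n; symmetry; apply Hs|].
    replace (plus _ _) with 0.
    + apply filterlim_ext with (fun _ : nat => 0); [|apply filterlim_const].
      intros n; rewrite sum_n_const; ring.
    + unfold plus, opp; simpl; rewrite wallis_0; ring. }
rewrite sin_0 in He; lra.
Qed.

(** By [weighted_S] the derivative is (6 - 16 y) B(y), and
    6 - 16 y = 8 cos x - 2. *)
Lemma is_derive_sin_PSeries_weighted (x : R) :
  0 <= x <= PI / 2 ->
  is_derive (fun t => sin t * PSeries weighted (hav t)) x
    ((8 * cos x - 2) * PSeries wallis (hav x)).
Proof.
intros Hx.
replace ((8 * cos x - 2) * PSeries wallis (hav x))
  with (PSeries (sin_derive_coef weighted) (hav x)).
{ apply is_derive_sin_PSeries; [apply weighted_geom_bounded|exact Hx]. }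
apply is_pseries_unique.
assert (HB : is_pseries wallis (hav x) (PSeries wallis (hav x))).
{ apply PSeries_correct, CV_radius_inside, geom_bounded_radius, hav_range;
    [apply wallis_geom_bounded|exact Hx]. }
assert (H1 := is_pseries_plus _ _ _ _ _
  (is_pseries_scal 6 _ _ _ (Rmult_comm _ _) HB)
  (is_pseries_scal (-16) _ _ _ (Rmult_comm _ _)
    (is_pseries_incr_1 _ _ _ HB))).
replace ((8 * cos x - 2) * PSeries wallis (hav x))
  with (plus (scal 6 (PSeries wallis (hav x)))
             (scal (-16) (scal (hav x) (PSeries wallis (hav x)))))
  by (unfold plus, scal; simpl; unfold mult, hav at 2; simpl; field).
revert H1; apply is_pseries_ext; intros [|n];
  unfold PS_plus, PS_scal, PS_incr_1, plus, scal, zero; simpl;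
  unfold mult; simpl.
- unfold weighted; rewrite harm_0; ring.
- rewrite weighted_S; ring.
Qed.

Definition summand_coef : nat -> R :=
  PS_incr_1 (fun n => weighted n / INR (S n)).

Lemma PS_derive_summand_coef (n : nat) :
  PS_derive summand_coef n = weighted n.
Proof.
unfold PS_derive, summand_coef, PS_incr_1.
assert (Hn := INR_S_pos n).
field; lra.
Qed.

Lemma summand_coef_radius (y : R) :
  Rabs y <= 1 / 2 -> Rbar_lt (Rabs y) (CV_radius summand_coef).
Proof.
intros Hy.
rewrite <- CV_radius_derive, (CV_radius_ext _ weighted PS_derive_summand_coef).
apply geom_bounded_radius; [apply weighted_geom_bounded|exact Hy].
Qed.

Lemma is_derive_summand_series (x : R) :
  0 <= x <= PI / 2 ->
  is_derive (fun t => PSeries summand_coef (hav t)) x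
    (sin x * PSeries weighted (hav x) / 2).
Proof.
intros Hx.
replace (sin x * PSeries weighted (hav x) / 2)
  with (scal (sin x / 2) (PSeries (PS_derive summand_coef) (hav x))).
- apply (is_derive_comp (PSeries summand_coef) hav); [|apply is_derive_hav].
  apply is_derive_PSeries, summand_coef_radius, hav_range, Hx.
- rewrite (PSeries_ext _ weighted _ PS_derive_summand_coef).
  unfold scal; simpl; unfold mult; simpl; field.
Qed.

Lemma is_series_summand :
  is_series (fun n => summand (S n)) (PSeries summand_coef (1 / 2)).
Proof.
assert (H : is_pseries summand_coef (1 / 2) (PSeries summand_coef (1 / 2))).
{ apply PSeries_correct, CV_radius_inside, summand_coef_radius.
  rewrite Rabs_pos_eq; lra. }
apply is_pseries_R in H.
apply (is_series_ext (fun n => summand_coef (S n) * (1 / 2) ^ S n)).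
{ intros n; symmetry; apply summand_weighted. }
apply (is_series_incr_1 (fun n => summand_coef n * (1 / 2) ^ n)).
replace (plus _ _) with (PSeries summand_coef (1 / 2)); [exact H|].
unfold summand_coef, PS_incr_1, plus, zero; simpl; ring.
Qed.

(** * The Dirichlet kernel *)

(** Summed over k <= n, the even frequencies up to 4n + 4 approximate
    8 cos x / sin x and the odd ones up to 2n + 1 approximate - 2 / sin x.  The
    even frequencies run twice as far so that the inverse cubes in
    [kernel_moment_term_eval] cancel exactly for each k. *)
Definition kernel_term (k : nat) (x : R) : R :=
  16 * sin ((4 * INR k + 2) * x) + 16 * sin ((4 * INR k + 4) * x)
  - 4 * sin ((2 * INR k + 1) * x).

Definition kernel (n : nat) (x : R) : R := sum_n (fun k => kernel_term k x) n.

Definition kernel_remainder (n : nat) (x : R) : R :=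
  8 * cos ((4 * INR n + 5) * x) - 2 * cos ((2 * INR n + 2) * x).

Lemma sin_mul_sin (x y : R) : 2 * (sin x * sin y) = cos (x - y) - cos (x + y).
Proof. rewrite cos_minus, cos_plus; ring. Qed.

Lemma sin_kernel_term (k : nat) (x : R) :
  sin x * kernel_term k x =
  8 * (cos ((4 * INR k + 1) * x) - cos ((4 * INR k + 5) * x))
  - 2 * (cos (2 * INR k * x) - cos ((2 * INR k + 2) * x)).
Proof.
unfold kernel_term.
assert (H1 := sin_mul_sin ((4 * INR k + 2) * x) x).
assert (H2 := sin_mul_sin ((4 * INR k + 4) * x) x).
assert (H3 := sin_mul_sin ((2 * INR k + 1) * x) x).
replace ((4 * INR k + 2) * x - x) with ((4 * INR k + 1) * x) in H1 by ring.
replace ((4 * INR k + 2) * x + x) with ((4 * INR k + 3) * x) in H1 by ring.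
replace ((4 * INR k + 4) * x - x) with ((4 * INR k + 3) * x) in H2 by ring.
replace ((4 * INR k + 4) * x + x) with ((4 * INR k + 5) * x) in H2 by ring.
replace ((2 * INR k + 1) * x - x) with (2 * INR k * x) in H3 by ring.
replace ((2 * INR k + 1) * x + x) with ((2 * INR k + 2) * x) in H3 by ring.
lra.
Qed.

Lemma sin_kernel (n : nat) (x : R) :
  8 * cos x - 2 = sin x * kernel n x + kernel_remainder n x.
Proof.
unfold kernel, kernel_remainder.
induction n as [|n IH].
- rewrite sum_O, sin_kernel_term; simpl INR.
  replace ((4 * 0 + 1) * x) with x by ring.
  replace (2 * 0 * x) with 0 by ring.
  rewrite cos_0; ring.
- rewrite sum_Sn; unfold plus; simpl plus.
  rewrite Rmult_plus_distr_l, sin_kernel_term, S_INR.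
  replace (4 * (INR n + 1) + 1) with (4 * INR n + 5) by ring.
  (* the kernel term telescopes against the two remainders *)
  replace (2 * (INR n + 1)) with (2 * INR n + 2) by ring.
  lra.
Qed.

(** A primitive of x (PI/2 - x) sin (m x), from two integrations by parts. *)
Definition sin_moment (m x : R) : R :=
  - (x * (PI / 2 - x)) * cos (m * x) / m
  + (PI / 2 - 2 * x) * sin (m * x) / m ^ 2 - 2 * cos (m * x) / m ^ 3.

Lemma is_derive_sin_moment (m x : R) :
  0 < m -> is_derive (sin_moment m) x (x * (PI / 2 - x) * sin (m * x)).
Proof.
intros Hm; unfold sin_moment; auto_derive.
- trivial.
- field; lra.
Qed.

Definition kernel_moment_term (k : nat) (x : R) : R :=
  16 * sin_moment (4 * INR k + 2) x + 16 * sin_moment (4 * INR k + 4) x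
  - 4 * sin_moment (2 * INR k + 1) x.

Definition kernel_moment (n : nat) (x : R) : R :=
  sum_n (fun k => kernel_moment_term k x) n.

Lemma is_derive_kernel_moment_term (k : nat) (x : R) :
  is_derive (kernel_moment_term k) x (x * (PI / 2 - x) * kernel_term k x).
Proof.
assert (Hk := pos_INR k).
unfold kernel_moment_term, kernel_term.
assert (H1 := is_derive_sin_moment (4 * INR k + 2) x ltac:(lra)).
assert (H2 := is_derive_sin_moment (4 * INR k + 4) x ltac:(lra)).
assert (H3 := is_derive_sin_moment (2 * INR k + 1) x ltac:(lra)).
assert (H := is_derive_minus _ _ _ _ _
  (is_derive_plus _ _ _ _ _ (is_derive_scal _ _ 16 _ H1)
                            (is_derive_scal _ _ 16 _ H2))
  (is_derive_scal _ _ 4 _ H3)).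
match type of H with is_derive _ _ ?d =>
  replace (x * (PI / 2 - x) * _) with d; [exact H|] end.
unfold minus, plus, opp; simpl; ring.
Qed.

Lemma is_derive_kernel_moment (n : nat) (x : R) :
  is_derive (kernel_moment n) x (x * (PI / 2 - x) * kernel n x).
Proof.
replace (x * (PI / 2 - x) * kernel n x)
  with (sum_n (fun k => x * (PI / 2 - x) * kernel_term k x) n).
- apply (is_derive_sum_n kernel_moment_term n x
    (fun k => x * (PI / 2 - x) * kernel_term k x)).
  intros k _; apply is_derive_kernel_moment_term.
- apply (sum_n_mult_l (x * (PI / 2 - x)) (fun k => kernel_term k x)).
Qed.

Definition catalan_term (k : nat) : R := (-1) ^ k / INR (2 * k + 1) ^ 2.

Lemma sin_odd_PI2 (k : nat) : sin ((2 * INR k + 1) * (PI / 2)) = (-1) ^ k.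
Proof.
induction k as [|k IH].
- simpl; replace ((2 * 0 + 1) * (PI / 2)) with (PI / 2) by ring.
  apply sin_PI2.
- rewrite S_INR.
  replace ((2 * (INR k + 1) + 1) * (PI / 2))
    with ((2 * INR k + 1) * (PI / 2) + PI) by field.
  rewrite neg_sin, IH; simpl; ring.
Qed.

Lemma cos_odd_PI2 (k : nat) : cos ((2 * INR k + 1) * (PI / 2)) = 0.
Proof.
replace ((2 * INR k + 1) * (PI / 2)) with (PI / 2 + INR k * PI) by field.
apply cos_eq_0_1; exists (Z.of_nat k); rewrite <- INR_IZR_INZ; ring.
Qed.

(** Both endpoints kill the weight x (PI/2 - x).  Frequency 4k+2 contributes
    16 * 4 / (4k+2)^3 = 8 / (2k+1)^3, frequency 4k+4 nothing, and frequency 2k+1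
    contributes - 8 / (2k+1)^3 together with the Catalan term. *)
Lemma kernel_moment_term_eval (k : nat) :
  kernel_moment_term k (PI / 2) - kernel_moment_term k 0
  = 2 * PI * catalan_term k.
Proof.
unfold kernel_moment_term, sin_moment, catalan_term.
assert (Hk := pos_INR k).
assert (H2 : forall j, sin (2 * INR j * PI) = 0 /\ cos (2 * INR j * PI) = 1).
{ intros j.
  assert (Hs := sin_period 0 j); assert (Hc := cos_period 0 j).
  rewrite Rplus_0_l, sin_0 in Hs; rewrite Rplus_0_l, cos_0 in Hc.
  split; assumption. }
destruct (H2 k) as [Hs Hc].
destruct (H2 (S k)) as [Hs' Hc'].
replace ((4 * INR k + 2) * (PI / 2)) with (2 * INR k * PI + PI) by field.
replace ((4 * INR k + 4) * (PI / 2)) with (2 * INR (S k) * PI)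
  by (rewrite S_INR; field).
rewrite neg_sin, neg_cos, Hs, Hc, Hs', Hc', sin_odd_PI2, cos_odd_PI2.
rewrite !Rmult_0_r, sin_0, cos_0.
rewrite plus_INR, mult_INR; simpl INR.
field.
repeat split; lra.
Qed.

Lemma kernel_moment_eval (n : nat) :
  kernel_moment n (PI / 2) - kernel_moment n 0
  = 2 * PI * sum_n catalan_term n.
Proof.
unfold kernel_moment.
induction n as [|n IH].
- rewrite !sum_O; apply kernel_moment_term_eval.
- rewrite !sum_Sn; unfold plus; simpl.
  assert (H := kernel_moment_term_eval (S n)); lra.
Qed.

(** * The oscillating remainder *)

(** By [sin_PSeries_wallis] this is 2 x (PI/2 - x) / sin x, the factor in front of
    the oscillating remainder; the power series shows that it is smooth at 0. *)
Definition amplitude (x : R) : R := (PI / 2 - x) * PSeries wallis (hav x).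

Definition amplitude_derive (x : R) : R :=
  - PSeries wallis (hav x)
  + (PI / 2 - x) * (sin x / 2 * PSeries (PS_derive wallis) (hav x)).

Lemma is_derive_amplitude (x : R) :
  0 <= x <= PI / 2 -> is_derive amplitude x (amplitude_derive x).
Proof.
intros Hx.
assert (H := is_derive_mult (fun t => PI / 2 - t)
  (fun t => PSeries wallis (hav t)) x (-1) _
  ltac:(auto_derive; [trivial|ring])
  (is_derive_PSeries_hav wallis x wallis_geom_bounded Hx)
  (fun _ _ => Rmult_comm _ _)).
match type of H with is_derive _ _ ?d =>
  replace (amplitude_derive x) with d; [exact H|] end.
unfold amplitude_derive, plus, mult; simpl; ring.
Qed.

Lemma amplitude_derive_bounded :
  exists M : R, forall x : R,
    0 <= x <= PI / 2 -> Rabs (amplitude_derive x) <= M.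
Proof.
destruct (bounded_continuity amplitude_derive 0 (PI / 2)) as [M HM].
- intros x Hx.
  assert (Hr : Rbar_lt (Rabs (hav x)) (CV_radius wallis))
    by (apply geom_bounded_radius, hav_range;
        [apply wallis_geom_bounded|assumption]).
  apply (ex_derive_continuous amplitude_derive x).
  unfold amplitude_derive, hav in *; auto_derive.
  repeat split.
  + eexists; apply is_derive_PSeries; exact Hr.
  + eexists; apply is_derive_PSeries; rewrite CV_radius_derive; exact Hr.
- exists M; intros x Hx; apply Rlt_le, (HM x Hx).
Qed.

Definition remainder_primitive (n : nat) (x : R) : R :=
  8 * sin ((4 * INR n + 5) * x) / (4 * INR n + 5)
  - 2 * sin ((2 * INR n + 2) * x) / (2 * INR n + 2).

Lemma is_derive_remainder_primitive (n : nat) (x : R) :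
  is_derive (remainder_primitive n) x (kernel_remainder n x).
Proof.
assert (Hn := pos_INR n).
unfold remainder_primitive, kernel_remainder; auto_derive; [trivial|].
field; lra.
Qed.

Lemma remainder_primitive_bound (n : nat) (x : R) :
  Rabs (remainder_primitive n x) <= 3 / (INR n + 1).
Proof.
assert (Hn := pos_INR n).
unfold remainder_primitive.
set (s := sin _); set (s' := sin ((2 * INR n + 2) * x)).
assert (Hs : -1 <= s <= 1) by apply SIN_bound.
assert (Hs' : -1 <= s' <= 1) by apply SIN_bound.
replace (8 * s / (4 * INR n + 5) - 2 * s' / (2 * INR n + 2))
  with ((8 * s * (INR n + 1) / (4 * INR n + 5) - s') / (INR n + 1))
  by (field; lra).
unfold Rdiv at 1; rewrite Rabs_mult, (Rabs_pos_eq (/ _))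
  by (apply Rlt_le, Rinv_0_lt_compat; lra).
apply Rmult_le_compat_r; [apply Rlt_le, Rinv_0_lt_compat; lra|].
assert (-2 <= 8 * s * (INR n + 1) / (4 * INR n + 5) <= 2).
{ split; [apply Rle_div_r|apply Rle_div_l]; nra. }
apply Rabs_le_between; lra.
Qed.

(** The first two summands form a primitive of
    (PI/2 - x) (8 cos x - 2) B(y), which is Taylor's formula.  The third removes the
    kernel part of it, and the last one is the boundary term of an integration
    by parts of the oscillating part, so that the derivative of the
    total keeps only the bounded derivative of the amplitude times a function
    of size O(1/n). *)
Definition defect (n : nat) (x : R) : R :=
  (PI / 2 - x) * (sin x * PSeries weighted (hav x))
  + 2 * PSeries summand_coef (hav x)
  - 2 * kernel_moment n x
  - amplitude x * remainder_primitive n x.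

Lemma is_derive_defect (n : nat) (x : R) :
  0 <= x <= PI / 2 ->
  is_derive (defect n) x (- (amplitude_derive x * remainder_primitive n x)).
Proof.
intros Hx.
assert (H1 := is_derive_mult (fun t => PI / 2 - t)
  (fun t => sin t * PSeries weighted (hav t)) x (-1) _
  ltac:(auto_derive; [trivial|ring])
  (is_derive_sin_PSeries_weighted x Hx) (fun _ _ => Rmult_comm _ _)).
assert (H2 := is_derive_scal _ _ 2 _ (is_derive_summand_series x Hx)).
assert (H3 := is_derive_scal _ _ 2 _ (is_derive_kernel_moment n x)).
assert (H4 := is_derive_mult amplitude (remainder_primitive n) x _ _
  (is_derive_amplitude x Hx) (is_derive_remainder_primitive n x)
  (fun _ _ => Rmult_comm _ _)).
assert (H := is_derive_minus _ _ _ _ _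
  (is_derive_minus _ _ _ _ _ (is_derive_plus _ _ _ _ _ H1 H2) H3) H4).
match type of H with is_derive _ _ ?d =>
  replace (- _) with d; [exact H|] end.
unfold minus, plus, opp, mult; simpl.
assert (Hw := sin_PSeries_wallis x Hx).
(* In B(y) sin x * kernel n x, the factor sin x * B(y) is 2 x. *)
rewrite (sin_kernel n x).
replace (2 * (x * (PI / 2 - x) * kernel n x))
  with ((2 * x) * ((PI / 2 - x) * kernel n x)) by ring.
rewrite <- Hw; unfold amplitude; field.
Qed.

(** At PI/2 the factors PI/2 - x vanish, and at 0 the sines and F do. *)
Lemma defect_eval (n : nat) :
  defect n (PI / 2) - defect n 0
  = 2 * (PSeries summand_coef (1 / 2) - 2 * PI * sum_n catalan_term n).
Proof.
assert (H := kernel_moment_eval n).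
unfold defect, amplitude, remainder_primitive, hav.
rewrite cos_PI2, cos_0, !Rmult_0_r, sin_0.
replace ((1 - 0) / 2) with (1 / 2) by field.
replace ((1 - 1) / 2) with 0 by field.
replace (PSeries summand_coef 0) with 0 by (symmetry; apply PSeries_0).
lra.
Qed.

Lemma catalan_partial_sums (M : R) (n : nat) :
  (forall x, 0 <= x <= PI / 2 -> Rabs (amplitude_derive x) <= M) ->
  Rabs (PSeries summand_coef (1 / 2) - 2 * PI * sum_n catalan_term n)
  <= 3 * PI / 4 * M / (INR n + 1).
Proof.
intros HM.
assert (Hn := pos_INR n).
assert (HPI := PI_RGT_0).
destruct (MVT_gen (defect n) 0 (PI / 2)
  (fun x => - (amplitude_derive x * remainder_primitive n x))) as [c [Hc E]].
- rewrite Rmin_left, Rmax_right by lra.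
  intros x Hx; apply is_derive_defect; lra.
- rewrite Rmin_left, Rmax_right by lra.
  intros x Hx; apply continuity_pt_filterlim.
  apply (ex_derive_continuous (defect n)).
  eexists; apply is_derive_defect; exact Hx.
- rewrite Rmin_left, Rmax_right in Hc by lra.
  rewrite defect_eval in E.
  replace (PSeries summand_coef (1 / 2) - 2 * PI * sum_n catalan_term n)
    with (- (PI / 4 * (amplitude_derive c * remainder_primitive n c))) by lra.
  rewrite Rabs_Ropp, Rabs_mult, Rabs_mult, (Rabs_pos_eq (PI / 4)) by lra.
  replace (3 * PI / 4 * M / (INR n + 1))
    with (PI / 4 * (M * (3 / (INR n + 1)))) by (field; lra).
  apply Rmult_le_compat_l; [lra|].
  apply Rmult_le_compat; try apply Rabs_pos.
  + apply HM, Hc.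
  + apply remainder_primitive_bound.
Qed.

(** The estimate on partial sums proves that Catalan's series converges and
    identifies its sum. *)
Lemma Catalan_eq : 2 * PI * Catalan = PSeries summand_coef (1 / 2).
Proof.
assert (HPI := PI_RGT_0).
destruct amplitude_derive_bounded as [M HM].
set (F := PSeries summand_coef (1 / 2)).
assert (Hlim : is_lim_seq (fun n => F - 2 * PI * sum_n catalan_term n) 0).
{ apply is_lim_seq_abs_0.
  apply is_lim_seq_le_le with (fun _ => 0)
    (fun n => 3 * PI / 4 * M * / INR (S n)).
  - intros n; split; [apply Rabs_pos|].
    rewrite S_INR; apply catalan_partial_sums, HM.
  - apply is_lim_seq_const.
  - replace 0 with (3 * PI / 4 * M * 0) by ring.
    apply (is_lim_seq_scal_l _ _ 0).
    apply (is_lim_seq_incr_1 (fun n => / INR n)).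
    replace (Finite 0) with (Rbar_inv p_infty) by reflexivity.
    apply is_lim_seq_inv; [apply is_lim_seq_INR|discriminate]. }
assert (Hser : is_series catalan_term (F / (2 * PI))).
{ change (is_lim_seq (sum_n catalan_term) (F / (2 * PI))).
  apply (is_lim_seq_ext
    (fun n => / (2 * PI) * (F - (F - 2 * PI * sum_n catalan_term n)))).
  { intros n; field; lra. }
  replace (Finite (F / (2 * PI))) with (Rbar_mult (/ (2 * PI)) (F - 0))
    by (simpl; f_equal; field; lra).
  apply is_lim_seq_scal_l.
  apply (is_lim_seq_minus' (fun _ => F) _ F 0);
    [apply is_lim_seq_const|exact Hlim]. }
unfold Catalan; fold catalan_term.
rewrite (is_series_unique _ _ Hser).
field; lra.
Qed.

Theorem mainTheorem10 :
  is_series (fun n : nat => summand (S n)) (2 * PI * Catalan).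
Proof.
rewrite Catalan_eq.
apply is_series_summand.
Qed.
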